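(* Let $H$ be a finite dimensional complex Hilbert space, $\lambda\in(0,1)$, and let $f_\lambda(x)=1-\lambda+\lambda x$. Then for any invertible $T\in\mathcal{B}(H)$ with polar decomposition $T=U|T|$, the limit $\lim_{n\to\infty}\Delta_{f_\lambda}^n(T)$ exists, and it does not depend on $\lambda$.
   Context: For an invertible $T$ with polar decomposition $T=U|T|$ ($U$ unitary, $|T|=(T^*T)^{1/2}$), the induced Aluthge transformation with respect to the $\lambda$-weighted arithmetic mean is $\Delta_{f_\lambda}(T)=(1-\lambda)|T|U+\lambda U|T|$ (which is again invertible). Iterates: $\Delta_{f_\lambda}^0(T)=T$, $\Delta_{f_\lambda}^n(T)=\Delta_{f_\lambda}(\Delta_{f_\lambda}^{n-1}(T))$. *)

(* Defs.v *)
From HB Require Import structures.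
From mathcomp Require Import all_boot all_order all_algebra.
From mathcomp Require Import sesquilinear complex.
From mathcomp Require Import all_classical all_reals all_analysis.

Set Implicit Arguments.
Unset Strict Implicit.
Unset Printing Implicit Defensive.

Import Order.TTheory GRing.Theory Num.Theory.
Import numFieldNormedType.Exports.

Local Open Scope classical_set_scope.
Local Open Scope ring_scope.
Local Open Scope complex_scope.

(* A finite-dimensional complex Hilbert space is a [vectType R[i]] carrying a
   positive definite hermitian form [dot], linear in its first argument and
   conjugate-linear in the second; completeness is automatic.  All operators
   are bounded, so B(H) is ['End(H)]. *)
Section Operators.
Context {R : realType} {H : vectType R[i]}.
Variable dot : {dot H for (@Num.conj R[i])}.
Implicit Types (S T U P : 'End(H)) (x y : H) (l : R).

Definition hnorm x : R := Num.sqrt (complex.Re (dot x x)).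

(* The set is nonempty, and bounded because H is finite dimensional, so [sup]
   is a genuine supremum. *)
Definition opnorm T : R := sup [set hnorm (T x) | x in [set x | hnorm x <= 1]].

Definition invertible T := exists S, (S \o T = \1)%VF /\ (T \o S = \1)%VF.

Definition is_adjoint T S := forall x y, dot (T x) y = dot x (S y).

Definition adjoint T : 'End(H) := xget 0 [set S | is_adjoint T S].

(* The order on R[i] makes [0 <= z] mean that z is real and nonnegative. *)
Definition positive_op T := forall x, 0 <= dot (T x) x.

Definition is_sqrt_op T P := positive_op P /\ (P \o P = T)%VF.

(* A positive operator has exactly one positive square root. *)
Definition sqrt_op T : 'End(H) := xget 0 [set P | is_sqrt_op T P].

Definition abs_op T : 'End(H) := sqrt_op (adjoint T \o T)%VF.

Definition unitary_op U :=
  (adjoint U \o U = \1)%VF /\ (U \o adjoint U = \1)%VF.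

(* For invertible T this is the only operator satisfying the condition. *)
Definition polar_factor T : 'End(H) :=
  xget 0 [set U | unitary_op U /\ (T = U \o abs_op T)%VF].

Definition aluthge l T : 'End(H) :=
  (1 - l)%:C *: (abs_op T \o polar_factor T)%VF
  + l%:C *: (polar_factor T \o abs_op T)%VF.

End Operators.

(* Main.v *)
Require Import Defs.
From HB Require Import structures.
From mathcomp Require Import all_boot all_order all_algebra.
From mathcomp Require Import sesquilinear spectral complex ring lra.
From mathcomp Require Import all_classical all_reals all_analysis.

Import Order.TTheory GRing.Theory Num.Theory.
Import numFieldNormedType.Exports.

Local Open Scope classical_set_scope.
Local Open Scope ring_scope.

(** Let T = U P be the polar decomposition of an invertible T.  Since
    P U = U (U^* P U), the transform satisfies
      (1 - l) P U + l U P = U ((1 - l) U^* P U + l P),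
    and the second factor is again positive definite.  By uniqueness of the
    polar decomposition the unitary factor of the transform is still U, so U
    is the same along the whole orbit, and the iteration is the linear one
      T_(n+1) = (1 - l) U^* T_n U + l T_n.
    In an orthonormal eigenbasis of U, with eigenvalues d_u of modulus 1, this
    acts on matrix coefficients diagonally:
      <T_n u, v> = mu_uv ^ n <T u, v>,  mu_uv = (1 - l) d_u (d_v)^* + l.
    If d_u = d_v then mu_uv = 1; otherwise mu_uv lies in the interior of a
    chord of the unit circle, so |mu_uv| < 1 and the coefficient tends to 0.
    The limit L therefore has the coefficients <T u, v> for d_u = d_v and 0
    elsewhere, and l is absent from it.  In other words L = U E(P), with E the
    orthogonal projection onto the commutant of U for the trace form.

    The facts about operators used here all come out of one spectral theorem,
    [orthonormal_eigenbasis]: it yields orthonormal bases, adjoints and square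
    roots, hence the polar decomposition [polar_exists]; [sqrt_op_uniq] gives
    its uniqueness, [aluthge_polar] the invariance of U, and
    [aluthge_iter_coef] the formula for the coefficients.  Convergence of
    coefficients gives convergence in operator norm by [opnorm_bounds]. *)

Set Implicit Arguments.
Unset Strict Implicit.
Unset Printing Implicit Defensive.

(** * Eigenvectors in stable subspaces *)

(** The matrix of the compression of N to V has an eigenvalue because C is
    algebraically closed; stability of V makes the compression equal to N
    on V. *)
Lemma stable_eigenvector (C : numClosedFieldType) (H : vectType C)
    (N : 'End(H)) (V : {vspace H}) :
  V != 0%VS -> (N @: V <= V)%VS ->
  exists a u, [/\ u \in V, u != 0 & N u = a *: u].
Proof.
move=> V0 NV; pose f : 'End(subvs_of V) := linfun (vsproj V \o N \o vsval).
pose e := vbasis {: subvs_of V}; have eB := vbasisP {: subvs_of V}.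
have dim_gt0 : (0 < \dim {: subvs_of V})%N.
  by rewrite dimvf /= lt0n dimv_eq0.
have [a /eigenvalueP[w wM w0]] := eigenvalue_closed (passmx.mxof e e f) dim_gt0.
have fw : f (passmx.vecof e w) = a *: passmx.vecof e w.
  rewrite (passmx.hom_vecof _ eB) wM /passmx.vecof scaler_sumr.
  by apply: eq_bigr => i _; rewrite mxE scalerA.
set y := passmx.vecof e w in fw.
exists a, (vsval y); split; first exact: subvsP.
  apply: contra_neq w0 => /(@val_inj _ _ _ y 0)/eqP.
  by rewrite passmx.vecof_eq0 // => /eqP.
have /(congr1 vsval) := fw.
by rewrite lfunE /= vsprojK // (subvP NV) // memv_img // subvsP.
Qed.

(** * Orthonormal bases *)

Section Basis.
Context {C : numClosedFieldType} {H : vectType C}.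
Variable dot : {dot H for (@Num.conj C)}.
Implicit Types (s : seq H) (x y u v : H) (S T U P N : 'End(H)).

(** Bases are duplicate-free sequences of vectors, so that an eigenvalue of N
    at a basis vector u is [dot (N u) u] and needs no separate indexing. *)
Definition is_onb s :=
  orthonormal dot s /\ forall x, x = \sum_(u <- s) dot x u *: u.

(** A relation rather than an operation, so that an adjoint can be exhibited
    before adjoints are known to exist in general. *)
Definition adjoints S T := forall x y, dot (S x) y = dot x (T y).

Lemma dotC x y : dot x y = (dot y x)^*.
Proof. by rewrite hermC /= expr0 mul1r. Qed.

Lemma dot_suml (I : Type) (r : seq I) (F : I -> H) y :
  dot (\sum_(i <- r) F i) y = \sum_(i <- r) dot (F i) y.
Proof. by rewrite linear_sumlz. Qed.

Lemma dot_sumr (I : Type) (r : seq I) (F : I -> H) x :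
  dot x (\sum_(i <- r) F i) = \sum_(i <- r) dot x (F i).
Proof. by rewrite linear_sumr. Qed.

Lemma dotDl x y z : dot (x + y) z = dot x z + dot y z.
Proof. exact: linearDl. Qed.

Lemma dotDr x y z : dot x (y + z) = dot x y + dot x z.
Proof. exact: linearDr. Qed.

Lemma dotBl x y z : dot (x - y) z = dot x z - dot y z.
Proof. exact: linearBl. Qed.

Lemma dotBr x y z : dot x (y - z) = dot x y - dot x z.
Proof. exact: linearBr. Qed.

Lemma dotZl a x y : dot (a *: x) y = a * dot x y.
Proof. by rewrite linearZl_LR. Qed.

Lemma dotZr a x y : dot x (a *: y) = a^* * dot x y.
Proof. by rewrite linearZr_LR. Qed.

Lemma dot_inj x y : (forall z, dot z x = dot z y) -> x = y.
Proof.
move=> xy; apply/eqP; rewrite -subr_eq0 -(dnorm_eq0 dot).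
by rewrite linearBr /= xy subrr.
Qed.

Lemma onb_dot s : is_onb s ->
  {in s &, forall u v, dot u v = (u == v)%:R}.
Proof. by case=> /orthonormalP[]. Qed.

Lemma onb_uniq s : is_onb s -> uniq s.
Proof. by case=> /orthonormalP[]. Qed.

Lemma dot_sum_onb s (a : H -> C) v : is_onb s -> v \in s ->
  dot (\sum_(u <- s) a u *: u) v = a v.
Proof.
move=> bs vs; rewrite dot_suml (bigD1_seq v) ?(onb_uniq bs) //= dotZl.
rewrite (onb_dot bs) // eqxx mulr1 big1_seq ?addr0 // => u /andP[uv us].
by rewrite /= dotZl (onb_dot bs) // (negPf uv) mulr0.
Qed.

Lemma onb_lfun_ext s S T : is_onb s -> {in s, S =1 T} -> S = T.
Proof.
move=> [_ sE] ST; apply/lfunP => x; rewrite [x]sE !linear_sum.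
by apply: eq_big_seq => u us; rewrite !linearZ /= ST.
Qed.

Definition extend s (g : H -> H) x := \sum_(u <- s) dot x u *: g u.

Fact extend_is_linear s g : linear (extend s g).
Proof.
move=> a x y; rewrite /extend scaler_sumr -big_split.
by apply: eq_bigr => u _; rewrite dotDl dotZl scalerDl scalerA.
Qed.

HB.instance Definition _ s g := GRing.isSemilinear.Build _ _ _ _ (extend s g)
  (GRing.semilinear_linear (extend_is_linear s g)).

Lemma extend_onb s g : is_onb s -> {in s, extend s g =1 g}.
Proof.
move=> bs u us; rewrite /extend (bigD1_seq u) ?(onb_uniq bs) //=.
rewrite (onb_dot bs) // eqxx scale1r big1_seq ?addr0 // => v /andP[vu vs].
by rewrite /= (onb_dot bs) // eq_sym (negPf vu) scale0r.
Qed.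

Lemma lfun_of_coefs s (c : H -> H -> C) : is_onb s ->
  exists T : 'End(H), {in s &, forall u v, dot (T u) v = c u v}.
Proof.
move=> bs; pose g u := \sum_(v <- s) c u v *: v.
exists (linfun (extend s g)) => u v us vs.
by rewrite lfunE /= extend_onb // (dot_sum_onb (c u)).
Qed.

(** * The spectral theorem for normal operators *)

(** Normality gives |N' u - a^* u| = |N u - a u| = 0; the proof expands the
    square of the left-hand side. *)
Lemma normal_eigenvector N N' a u : adjoints N N' ->
  (N \o N' = N' \o N)%VF -> N u = a *: u -> N' u = a^* *: u.
Proof.
move=> adj com Nu; apply/eqP; rewrite -subr_eq0 -(dnorm_eq0 dot).
have uN'u : dot u (N' u) = a * dot u u by rewrite -adj Nu dotZl.
have N'uu : dot (N' u) u = a^* * dot u u by rewrite dotC uN'u rmorphM /= -dotC.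
have N'uN'u : dot (N' u) (N' u) = a * (a^* * dot u u).
  by rewrite -adj -comp_lfunE com comp_lfunE Nu linearZ /= dotZl N'uu.
rewrite dotBl !dotBr !dotZl !dotZr conjCK N'uN'u uN'u N'uu.
by apply/eqP; ring.
Qed.

(** Induction on a subspace V stable under N and its adjoint N': a unit
    eigenvector u of N in V is also one of N', and therefore the orthogonal
    complement of u in V is again stable under both. *)
Lemma orthonormal_eigenbasis N N' : adjoints N N' ->
  (N \o N' = N' \o N)%VF ->
  exists2 s, is_onb s & {in s, forall u, N u = dot (N u) u *: u}.
Proof.
move=> adj com.
suff main (n : nat) (V : {vspace H}) : (\dim V <= n)%N -> (N @: V <= V)%VS ->
    (N' @: V <= V)%VS -> exists s,
    [/\ {in s, forall u, u \in V}, orthonormal dot s,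
        {in s, forall u, N u = dot (N u) u *: u}
      & {in V, forall x, x = \sum_(u <- s) dot x u *: u}].
  have [s [_ os eig sE]] := main _ fullv (leqnn _) (subvf _) (subvf _).
  by exists s => //; split=> // x; apply: sE; rewrite memvf.
elim: n V => [|n IHn] V dimV NV N'V; have [V0|V0] := eqVneq V 0%VS.
1,3: by exists [::]; split=> // x; rewrite V0 memv0 => /eqP->; rewrite big_nil.
  by move: dimV; rewrite leqn0 dimv_eq0 (negPf V0).
have [a [w [wV w0 Nw]]] := stable_eigenvector V0 NV.
pose u := (sqrtC (dot w w))^-1 *: w.
have uV : u \in V by rewrite memvZ.
have Nu : N u = a *: u by rewrite linearZ /= Nw !scalerA mulrC.
have uu1 : dot u u = 1.
  rewrite dnormZ normrV ?unitfE ?sqrtC_eq0 ?dnorm_eq0 // exprVn.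
  by rewrite ger0_norm ?sqrtC_ge0 // sqrtCK mulVf // dnorm_eq0.
have N'u := normal_eigenvector adj com Nu.
pose W := (V :&: orthov dot <[u]>)%VS.
have inW x : (x \in W) = (x \in V) && (dot x u == 0).
  by rewrite memv_cap mem_orthov1.
have uW : u \notin W by rewrite inW uu1 oner_eq0 andbF.
have dimW : (\dim W <= n)%N.
  rewrite -ltnS (leq_trans _ dimV) // ltn_neqAle dimvS ?capvSl // andbT.
  apply: contraNneq uW => dimWV.
  by have /eqP-> : W == V by rewrite eqEdim capvSl dimWV /=.
have NW : (N @: W <= W)%VS.
  apply/subvP => _ /memv_imgP[x + ->]; rewrite !inW => /andP[xV /eqP xu].
  by rewrite (subvP NV) ?memv_img // adj N'u dotZr xu mulr0 eqxx.
have N'W : (N' @: W <= W)%VS.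
  apply/subvP => _ /memv_imgP[x + ->]; rewrite !inW => /andP[xV /eqP xu].
  rewrite (subvP N'V) ?memv_img // dotC -adj Nu dotZl (dotC u) xu.
  by rewrite conjC0 mulr0 conjC0 eqxx.
have [s [sW os eig sE]] := IHn W dimW NW N'W.
have us x : x \in s -> dot x u = 0 by move/sW; rewrite inW => /andP[_ /eqP].
exists (u :: s); split.
- move=> x; rewrite inE => /predU1P[->|/sW] //.
  by rewrite inW => /andP[].
- rewrite -cat1s orthonormal_cat os /=; apply/andP; split.
    by rewrite /orthonormal /= uu1 eqxx.
  by apply/orthoPl => x xs; rewrite dotC us // conjC0.
- move=> x; rewrite inE => /predU1P[->|/eig//].
  by rewrite Nu dotZl uu1 mulr1.
(* The component of x along u is split off; the rest lies in W. *)
move=> x xV; rewrite big_cons; apply/eqP; rewrite addrC -subr_eq; apply/eqP.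
rewrite [LHS]sE ?inW ?memvB ?memvZ //=.
  apply: eq_big_seq => v vs; rewrite dotBl dotZl (dotC u) (us v) //.
  by rewrite conjC0 mulr0 subr0.
by rewrite dotBl dotZl uu1 mulr1 subrr.
Qed.

Lemma onb_exists : exists s, is_onb s.
Proof.
have [||s bs _] := @orthonormal_eigenbasis \1%VF \1%VF; last by exists s.
- by move=> x y; rewrite !id_lfunE.
- by rewrite comp_lfun1l.
Qed.

(** * Adjoints, square roots and the polar decomposition *)

Lemma adjoints_sym S T : adjoints S T -> adjoints T S.
Proof. by move=> adj x y; rewrite dotC -adj -dotC. Qed.

Lemma adjoints_uniq S T T' : adjoints S T -> adjoints S T' -> T = T'.
Proof.
by move=> adj adj'; apply/lfunP => y; apply: dot_inj => x; rewrite -adj -adj'.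
Qed.

Lemma adjoints_comp S T S' T' : adjoints S S' -> adjoints T T' ->
  adjoints (S \o T)%VF (T' \o S')%VF.
Proof. by move=> sS sT x y; rewrite !comp_lfunE sS sT. Qed.

Lemma adjoints_onb s S T : is_onb s ->
  {in s &, forall u v, dot (S u) v = dot u (T v)} -> adjoints S T.
Proof.
move=> [_ sE] ST x y; rewrite [x]sE [y]sE (linear_sum S) (linear_sum T).
rewrite !dot_suml; apply: eq_big_seq => u us.
rewrite !dot_sumr; apply: eq_big_seq => v vs.
rewrite /= [S _]linearZ [T _]linearZ /=.
by rewrite !dotZl !dotZr ST.
Qed.

Lemma adjoint_exists T : exists S, adjoints T S.
Proof.
have [s bs] := onb_exists.
have [S SE] := lfun_of_coefs (fun u v => (dot (T v) u)^*) bs.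
exists S; apply: (adjoints_onb bs) => u v us vs.
by rewrite [RHS]dotC SE // conjCK.
Qed.

(** Self-adjointness is recorded so that the spectral theorem applies to P at
    once; both conditions pass through the Aluthge iteration. *)
Definition posdef P := adjoints P P /\ forall x, x != 0 -> 0 < dot (P x) x.

Lemma posdef_lker0 P : posdef P -> lker P == 0%VS.
Proof.
move=> [_ P0]; rewrite -subv0; apply/subvP => x.
rewrite memv_ker memv0 => /eqP Px; apply: contraTT isT => x0.
by have := P0 x x0; rewrite Px linear0l ltxx.
Qed.

(** On an eigenvector u of P with eigenvalue r > 0, the vector
    y = S u - r u satisfies (S + r) y = (S ^ 2 - r ^ 2) u = 0, that is
    S y = - r y, which positivity of S allows only for y = 0. *)
Lemma sqrt_op_uniq P S : posdef P -> (forall x, 0 <= dot (S x) x) ->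
  (S \o S = P \o P)%VF -> S = P.
Proof.
move=> [Padj P0] S0 SP.
have [s bs Peig] := orthonormal_eigenbasis Padj erefl.
apply: (onb_lfun_ext bs) => u us; set r := dot (P u) u.
have Pu : P u = r *: u by exact: Peig.
have r0 : 0 < r.
  by apply: P0; rewrite -(dnorm_eq0 dot) (onb_dot bs) // eqxx oner_eq0.
have Sy : S (S u - r *: u) = - r *: (S u - r *: u).
  have SSu : S (S u) = r *: (r *: u).
    by rewrite -comp_lfunE SP comp_lfunE Pu linearZ /= Pu.
  by rewrite linearB /= SSu [S (r *: u)]linearZ /= scaleNr scalerBr opprB.
rewrite Pu; apply/eqP; rewrite -subr_eq0 -(dnorm_eq0 dot) eq_le dnorm_ge0 andbT.
by have := S0 (S u - r *: u); rewrite Sy dotZl mulNr oppr_ge0 pmulr_rle0.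
Qed.

Lemma posdef_sqrt A : posdef A -> exists2 P, posdef P & (P \o P = A)%VF.
Proof.
move=> [Aadj A0]; have [s bs Aeig] := orthonormal_eigenbasis Aadj erefl.
pose r u := sqrtC (dot (A u) u).
have r0 u : u \in s -> 0 < r u.
  move=> us; rewrite sqrtC_gt0; apply: A0.
  by rewrite -(dnorm_eq0 dot) (onb_dot bs) // eqxx oner_eq0.
pose P : 'End(H) := linfun (extend s (fun u => r u *: u)).
have PE u : u \in s -> P u = r u *: u.
  by move=> us; rewrite lfunE /= extend_onb.
exists P; last first.
  apply: (onb_lfun_ext bs) => u us.
  rewrite comp_lfunE (PE u us) linearZ /= (PE u us) scalerA -expr2 sqrtCK.
  by rewrite -Aeig.
split=> [|x x0].
  apply: (adjoints_onb bs) => u v us vs.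
  rewrite !PE // dotZl dotZr (onb_dot bs) //.
  have [->|] := eqVneq u v; last by rewrite !mulr0.
  by rewrite geC0_conj // ltW // r0.
have dotPx : dot (P x) x = \sum_(u <- s) r u * `|dot x u| ^+ 2.
  rewrite lfunE /= /extend dot_suml; apply: eq_bigr => u _.
  by rewrite !dotZl (dotC u) normCK; ring.
have ge0 u : u \in s -> 0 <= r u * `|dot x u| ^+ 2.
  by move=> us; rewrite mulr_ge0 ?exprn_ge0 // ltW // r0.
rewrite dotPx big_seq lt_def (@sumr_ge0 _ _ s (mem s)) // andbT.
rewrite (@psumr_eq0 _ _ s (mem s)) //; apply: contraNN x0 => /allP xu.
rewrite (bs.2 x); apply/eqP.
apply: big1_seq => u /= us; have /implyP/(_ us) := xu u us.
rewrite mulf_eq0 gt_eqF ?r0 //= expf_eq0 normr_eq0 /= => /eqP->.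
by rewrite scale0r.
Qed.

Definition unitary_pair U U' :=
  [/\ adjoints U U', (U' \o U = \1)%VF & (U \o U' = \1)%VF].

(** P is the square root of T^* T and U = T P^-1, whose adjoint P^-1 T^* is a
    left inverse, hence also equal to its right inverse P T^-1. *)
Lemma polar_exists T S : (S \o T = \1)%VF -> (T \o S = \1)%VF ->
  exists U U' P, [/\ unitary_pair U U', posdef P & T = (U \o P)%VF].
Proof.
move=> ST TS; have [T' TT'] := adjoint_exists T.
have pdA : posdef (T' \o T)%VF.
  split; first exact: adjoints_comp (adjoints_sym TT') TT'.
  move=> x x0; rewrite comp_lfunE dotC -TT' -dotC dnorm_gt0.
  by apply: contra_neq x0 => Tx; rewrite -[x]id_lfunE -ST comp_lfunE Tx linear0.
have [P pdP PP] := posdef_sqrt pdA.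
have P0 := posdef_lker0 pdP.
pose Q := (P^-1)%VF.
have PQ : (P \o Q = \1)%VF by exact: lker0_compfV.
have QP : (Q \o P = \1)%VF by exact: lker0_compVf.
have Qadj : adjoints Q Q.
  move=> x y; rewrite -[x in RHS]id_lfunE -PQ comp_lfunE pdP.1 -comp_lfunE PQ.
  by rewrite id_lfunE.
have UV : (T \o Q \o (P \o S) = \1)%VF.
  by rewrite -!comp_lfunA [(Q \o _)%VF]comp_lfunA QP comp_lfun1l.
have VU : (Q \o T' \o (T \o Q) = \1)%VF.
  rewrite -!comp_lfunA [(T' \o _)%VF]comp_lfunA -PP !comp_lfunA QP.
  by rewrite comp_lfun1l PQ.
exists (T \o Q)%VF, (Q \o T')%VF, P; split=> //.
  split=> //; first exact: adjoints_comp.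
  suff -> : (Q \o T')%VF = (P \o S)%VF by [].
  rewrite -[LHS]comp_lfun1r -UV !comp_lfunA.
  by rewrite -[(Q \o T' \o T \o Q)%VF]comp_lfunA VU comp_lfun1l.
by rewrite -comp_lfunA QP comp_lfun1r.
Qed.

Lemma posdef_conj_comb U U' P (a b : C) : unitary_pair U U' -> posdef P ->
  0 <= a -> 0 < b -> posdef (a *: (U' \o P \o U) + b *: P)%VF.
Proof.
move=> [UU' _ _] [Padj P0] a0 b0; split=> [x y|x x0].
  rewrite !lfun_simp dotDl dotDr !dotZl !dotZr.
  rewrite !geC0_conj ?(ltW b0) // Padj.
  by rewrite (adjoints_sym UU') Padj UU'.
rewrite !lfun_simp dotDl !dotZl (adjoints_sym UU').
rewrite ltr_wpDl ?mulr_gt0 ?P0 // mulr_ge0 //.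
by have [->|Ux] := eqVneq (U x) 0; rewrite ?linear0r // ltW // P0.
Qed.

Lemma eigenvalue_norm s U U' u : is_onb s -> unitary_pair U U' -> u \in s ->
  U u = dot (U u) u *: u -> `|dot (U u) u| = 1.
Proof.
move=> bs [UU' U'U _] us eig; apply/eqP.
have uu : dot u u = 1 by rewrite (onb_dot bs) // eqxx.
rewrite -(@pexpr_eq1 _ _ 2) // normCK -[dot (U u) u in X in _ * X]mulr1 -uu.
have : dot (U u) (U u) = 1 by rewrite UU' -comp_lfunE U'U id_lfunE.
by rewrite {2}eig dotZr mulrC uu mulr1 => ->.
Qed.

(** Moving U' to the right argument turns it into U, and then U meets an
    eigenvector on both sides: conjugation multiplies the coefficient by a
    scalar. *)
Lemma conj_coef U U' T u v : unitary_pair U U' ->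
  U u = dot (U u) u *: u -> U v = dot (U v) v *: v ->
  dot ((U' \o T \o U)%VF u) v = dot (U u) u * (dot (U v) v)^* * dot (T u) v.
Proof.
move=> [UU' _ _] Uu Uv; rewrite !comp_lfunE (adjoints_sym UU') {1}Uu {1}Uv.
by rewrite [T _]linearZ /= dotZl dotZr mulrA.
Qed.

(** * Norm estimates *)

Lemma norm_sum_le (I : Type) (r : seq I) (F : I -> H) :
  sqrtC (dot (\sum_(i <- r) F i) (\sum_(i <- r) F i)) <=
  \sum_(i <- r) sqrtC (dot (F i) (F i)).
Proof.
elim: r => [|i r IHr]; first by rewrite !big_nil linear0l sqrtC0.
by rewrite !big_cons (le_trans (triangle_lerif _ _ _)) // lerD2l.
Qed.

(** Expand x, then each T u, in the basis; Cauchy-Schwarz bounds the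
    coordinates of x by its norm. *)
Lemma norm_lfun_le s T x : is_onb s ->
  sqrtC (dot (T x) (T x)) <=
  sqrtC (dot x x) * \sum_(u <- s) \sum_(v <- s) `|dot (T u) v|.
Proof.
move=> bs.
have norm1 u : u \in s -> sqrtC (dot u u) = 1.
  by move=> us; rewrite (onb_dot bs) // eqxx sqrtC1.
have normZ (a : C) y : sqrtC (dot (a *: y) (a *: y)) = `|a| * sqrtC (dot y y).
  rewrite dnormZ sqrtCM ?nnegrE ?exprn_ge0 ?dnorm_ge0 //.
  by rewrite sqrCK.
rewrite {1 2}(bs.2 x) linear_sum (le_trans (norm_sum_le _ _)) // mulr_sumr.
rewrite !big_seq; apply: ler_sum => u us; rewrite linearZ /= normZ.
apply: ler_pM => //; first by rewrite sqrtC_ge0.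
  by have := CauchySchwarz_sqrt dot x u; rewrite (norm1 u) // mulr1 => -[].
rewrite {1 2}(bs.2 (T u)) (le_trans (norm_sum_le _ _)) //.
by rewrite !big_seq; apply: ler_sum => v vs; rewrite normZ norm1 // mulr1.
Qed.

End Basis.

Local Open Scope complex_scope.

Section OperatorNorm.
Context {R : realType} {H : vectType R[i]}.
Variable dot : {dot H for (@Num.conj R[i])}.

Lemma hnormE x : (hnorm dot x)%:C = sqrtC (dot x x).
Proof.
have xx := dnorm_ge0 dot x.
rewrite -[RHS]/(sqrtC _) -[dot x x]RRe_real ?ger0_real //.
rewrite -[complex.Re (dot x x)]sqr_sqrtr; last first.
  by rewrite -ler0c RRe_real ?ger0_real.
by rewrite rmorphXn /= sqrCK // ler0c sqrtr_ge0.
Qed.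

(** The lower bound rests on the upper one: a supremum is at least its member
    0 only if the set is bounded above. *)
Lemma opnorm_bounds s X : is_onb dot s ->
  0 <= opnorm dot X <= \sum_(u <- s) \sum_(v <- s) complex.Re `|dot (X u) v|.
Proof.
move=> bs; set M := \sum_(u <- s) _.
have ME : M%:C = \sum_(u <- s) \sum_(v <- s) `|dot (X u) v|.
  rewrite rmorph_sum; apply: eq_bigr => u _.
  by rewrite rmorph_sum; apply: eq_bigr => v _.
have ubM : ubound [set hnorm dot (X x) | x in [set x | hnorm dot x <= 1]] M.
  move=> _ [x /= x1 <-]; rewrite -lecR hnormE (le_trans (norm_lfun_le _ _ bs)) //.
  rewrite -hnormE -ME -rmorphM lecR ler_piMl //.
  by rewrite -ler0c ME sumr_ge0 // => u _; rewrite sumr_ge0.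
have in0 : [set hnorm dot (X x) | x in [set x | hnorm dot x <= 1]] 0.
  exists 0; rewrite /= /hnorm ?linear0 ?linear0r /= sqrtr0 //.
apply/andP; split; last by apply: ge_sup => //; exists 0.
by apply: ub_le_sup => //; exists M.
Qed.

End OperatorNorm.

Lemma cvg_sum_seq0 (R : realType) (I : eqType) (r : seq I) (F : I -> nat -> R) :
  {in r, forall i, F i n @[n --> \oo] --> 0} ->
  \sum_(i <- r) F i n @[n --> \oo] --> 0.
Proof.
elim: r => [_|i r IHr cvgF].
  by under eq_cvg do rewrite big_nil; exact: cvg_cst.
have cvg_i : F i n @[n --> \oo] --> 0 by apply: cvgF; rewrite mem_head.
have cvg_r : \sum_(j <- r) F j n @[n --> \oo] --> 0.
  by apply: IHr => j jr; apply: cvgF; rewrite in_cons jr orbT.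
have -> : (fun n => \sum_(j <- i :: r) F j n) =
    F i \+ (fun n => \sum_(j <- r) F j n).
  by apply/funext => n; rewrite big_cons.
rewrite -[X in _ --> X]addr0; exact: cvgD cvg_i cvg_r.
Qed.

(** * The Aluthge transform of a polar decomposition *)

Section Aluthge.
Context {R : realType} {H : vectType R[i]}.
Variable dot : {dot H for (@Num.conj R[i])}.
Implicit Types (x y u v : H) (S T U P N : 'End(H)).

Lemma adjointE T S : adjoints dot T S -> adjoint dot T = S.
Proof.
move=> TS; apply: (adjoints_uniq _ TS).
exact: (@xgetPex _ 0 [set S | is_adjoint dot T S] (ex_intro _ S TS)).
Qed.

Lemma abs_opE U U' P : unitary_pair dot U U' -> posdef dot P ->
  abs_op dot (U \o P)%VF = P.
Proof.
move=> [UU' U'U _] pdP; rewrite /abs_op.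
rewrite (adjointE (adjoints_comp UU' pdP.1)) comp_lfunA.
rewrite -[(P \o U' \o U)%VF]comp_lfunA U'U comp_lfun1r.
have sqP : is_sqrt_op dot (P \o P)%VF P.
  split=> // x; have [->|x0] := eqVneq x 0; first by rewrite linear0r.
  by rewrite ltW // pdP.2.
have [S0 SS] :=
  @xgetPex _ 0 [set S | is_sqrt_op dot (P \o P)%VF S] (ex_intro _ P sqP).
exact: sqrt_op_uniq pdP S0 SS.
Qed.

Lemma polar_factorE U U' P : unitary_pair dot U U' -> posdef dot P ->
  polar_factor dot (U \o P)%VF = U.
Proof.
move=> uU pdP; rewrite /polar_factor (abs_opE uU pdP).
have Uin : unitary_op dot U /\ (U \o P = U \o P)%VF.
  by case: uU => UU' U'U UU'1; rewrite /unitary_op (adjointE UU').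
have [_] := @xgetPex _ 0
  [set V | unitary_op dot V /\ (U \o P = V \o P)%VF] (ex_intro _ U Uin).
set V := xget _ _ => /(congr1 (fun S => S \o P^-1)%VF).
by rewrite !lker0_compfK ?(posdef_lker0 pdP).
Qed.

(** The key point: P U = U (U^* P U), so the unitary factor of the transform
    is again U.  The second equation is what the iteration does to
    coefficients, once U is known not to change. *)
Lemma aluthge_polar U U' P (l : R) : unitary_pair dot U U' -> posdef dot P ->
  let T := (U \o P)%VF in
  let P1 := ((1 - l)%:C *: (U' \o P \o U) + l%:C *: P)%VF in
  aluthge dot l T = (U \o P1)%VF /\
  aluthge dot l T = ((1 - l)%:C *: (U' \o T \o U) + l%:C *: T)%VF.
Proof.
move=> uU pdP T P1; rewrite /aluthge (abs_opE uU pdP) (polar_factorE uU pdP).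
have [_ U'U UU'] := uU.
rewrite /P1 comp_lfunDr -!comp_lfunZr !comp_lfunA UU' U'U.
by rewrite !comp_lfun1l.
Qed.

(** The positive definite factor has to be carried along the induction, since
    the transform only reads off U through the polar decomposition. *)
Lemma aluthge_iter_coef (s : seq H) U U' P (l : R) n : unitary_pair dot U U' ->
  posdef dot P -> {in s, forall u, U u = dot (U u) u *: u} -> 0 < l < 1 ->
  {in s &, forall u v, dot (iter n (aluthge dot l) (U \o P)%VF u) v =
    ((1 - l)%:C * (dot (U u) u * (dot (U v) v)^*) + l%:C) ^+ n *
    dot ((U \o P)%VF u) v}.
Proof.
move=> uU pdP eig /andP[l0 l1]; set T := (U \o P)%VF.
suff [_ //] : (exists2 Pn, posdef dot Pn &
    iter n (aluthge dot l) T = (U \o Pn)%VF) /\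
  {in s &, forall u v, dot (iter n (aluthge dot l) T u) v =
    ((1 - l)%:C * (dot (U u) u * (dot (U v) v)^*) + l%:C) ^+ n * dot (T u) v}.
elim: n => [|n [[Pn pdPn Tn] IHn]] /=.
  by split; [exists P | move=> u v _ _; rewrite expr0 mul1r].
have [E1 E2] := aluthge_polar l uU pdPn; rewrite -Tn in E1 E2; split.
  eexists; last exact: E1.
  by apply: posdef_conj_comb uU pdPn _ _; rewrite ?ler0c ?ltcR ?subr_ge0 // ltW.
move=> u v us vs; rewrite E2 add_lfunE !scale_lfunE dotDl !dotZl.
rewrite (conj_coef _ uU (eig u us) (eig v vs)) IHn // exprS.
by ring.
Qed.

(** The combination is interior to the chord from w to 1: with w = a + i b its
    squared modulus is 1 - 2 l (1 - l) (1 - a), and a < 1. *)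
Lemma convex_unit_lt1 (l : R) (w : R[i]) : 0 < l < 1 -> `|w| = 1 -> w != 1 ->
  complex.Re `|(1 - l)%:C * w + l%:C| < 1.
Proof.
case: w => a b /andP[l0 l1]; rewrite !normc_def /= => -[ab] w1.
have {}ab : a ^+ 2 + b ^+ 2 = 1.
  by rewrite -[LHS]sqr_sqrtr ?ab ?expr1n // addr_ge0 ?sqr_ge0.
have a1 : a < 1.
  rewrite lt_neqAle; apply/andP; split; last by nra.
  apply: contraNneq w1 => a1; move: ab; rewrite a1 expr1n.
  move=> /(canRL (addKr _)); rewrite addNr => /eqP.
  by rewrite sqrf_eq0 => /eqP->.
rewrite -[ltRHS]sqrtr1 ltr_sqrt //.
rewrite [ltLHS](_ : _ = 1 - 2 * (l * (1 - l) * (1 - a))).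
  by rewrite gtrBl !mulr_gt0 // subr_gt0.
have -> : 1 - 2 * (l * (1 - l) * (1 - a)) =
    (1 - l) ^+ 2 * (a ^+ 2 + b ^+ 2) + 2 * l * (1 - l) * a + l ^+ 2.
  by rewrite ab; ring.
by ring.
Qed.

End Aluthge.

(** * Convergence of the iterates *)

Unset Implicit Arguments.

Theorem theorem5p5 (R : realType) (H : vectType R[i])
    (dot : {dot H for (@Num.conj R[i])}) (T : 'End(H)) :
  invertible T ->
  exists L : 'End(H), forall l : R, 0 < l < 1 ->
    (fun n : nat => opnorm dot (iter n (aluthge dot l) T - L)) @ \oo --> (0 : R).
Proof.
move=> [S [ST TS]].
have [U [U' [P [uU pdP TE]]]] := polar_exists dot ST TS.
have [UU' U'U UU'1] := uU.
have com : (U \o U')%VF = (U' \o U)%VF by rewrite U'U UU'1.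
have [s bs eig] := orthonormal_eigenbasis UU' com.
pose d u := dot (U u) u.
have [L LE] :=
  lfun_of_coefs (fun u v => if d u == d v then dot (T u) v else 0) bs.
exists L => l l01.
pose mu u v := (1 - l)%:C * (d u * (d v)^*) + l%:C.
have Tn n : {in s &, forall u v,
    dot (iter n (aluthge dot l) T u) v = mu u v ^+ n * dot (T u) v}.
  by rewrite TE; exact: (aluthge_iter_coef n uU pdP eig l01).
have dd u : u \in s -> d u * (d u)^* = 1.
  by move=> us; rewrite -normCK (eigenvalue_norm bs uU us (eig u us)) expr1n.
have coef n u v : u \in s -> v \in s ->
    complex.Re `|dot ((iter n (aluthge dot l) T - L) u) v| =
    if d u == d v then 0
    else complex.Re `|mu u v| ^+ n * complex.Re `|dot (T u) v|.
  move=> us vs; rewrite add_lfunE opp_lfunE dotBl Tn // LE //.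
  case: eqP => [duv|_].
    rewrite /mu -duv dd // mulr1 -rmorphD subrK expr1n mul1r subrr.
    by rewrite normr0.
  rewrite subr0 normrM normrX.
  by rewrite -[`|mu u v|]RRe_real // -[`|dot _ _|]RRe_real // -rmorphXn -rmorphM.
apply: (@squeeze_cvgr _ _ _ _ (fun=> 0) (fun n => \sum_(u <- s) \sum_(v <- s)
  complex.Re `|dot ((iter n (aluthge dot l) T - L) u) v|)).
- by apply: nearW => n; exact: opnorm_bounds.
- exact: cvg_cst.
apply: cvg_sum_seq0 => u us; apply: cvg_sum_seq0 => v vs.
have [duv|duv] := eqVneq (d u) (d v).
  have -> : (fun n => complex.Re `|dot ((iter n (aluthge dot l) T - L) u) v|) =
      fun=> 0 by apply/funext => n; rewrite coef // duv eqxx.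
  exact: cvg_cst.
have -> : (fun n => complex.Re `|dot ((iter n (aluthge dot l) T - L) u) v|) =
    fun n => complex.Re `|mu u v| ^+ n * complex.Re `|dot (T u) v|.
  by apply/funext => n; rewrite coef // (negPf duv).
rewrite -[X in _ --> X](mul0r (complex.Re `|dot (T u) v|)).
apply: cvgMr_tmp; apply: cvg_expr.
rewrite ger0_norm; last by rewrite -ler0c RRe_real.
apply: convex_unit_lt1 => //.
  rewrite normrM norm_conjC (eigenvalue_norm bs uU us (eig u us)).
  by rewrite (eigenvalue_norm bs uU vs (eig v vs)) mulr1.
apply: contraNneq duv => duv; rewrite -[d u]mulr1 -(dd v vs).
by rewrite mulrCA duv mulr1.
Qed.
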